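(* Let $N,T,\nu\ge 1$ be integers, let $\bar{\boldsymbol\rho}\in\mathcal S^N$, let $f:\mathbb{R}^{NT}\to\mathbb{R}$ be convex, and let $\mathbf c=(c_1,\dots,c_\nu)$ be a tractable constraint function (defined in the context). Let $\mathcal I\subseteq\{1,\dots,\nu\}$ be the set of indices $l$ such that $c_l$ is of form (C), and assume that there exists at least one tuple $(\mathbf\Pi^0,\dots,\mathbf\Pi^{T-1})$ with $\mathbf\Pi^t\in\mathcal P^N$ for $t=0,\dots,T-1$ and $c_l(\mathbf\Pi^0,\dots,\mathbf\Pi^{T-1})\le 0$ for all $l\in\mathcal I$. Consider the problem $$ (\mathrm{P1})\quad \begin{aligned} \min_{\mathbf\Pi^t\in\mathcal P^N,\ \boldsymbol\rho^t\in\mathbb{R}^N_{\ge 0}}\ & f(\boldsymbol\rho^1,\dots,\boldsymbol\rho^T)\\ \text{subject to: }\ & \boldsymbol\rho^{t+1}=\mathbf\Pi^t\boldsymbol\rho^t,\quad t=0,\dots,T-1,\\ & \mathbf c(\boldsymbol\rho^0,\dots,\boldsymbol\rho^T,\mathbf\Pi^0,\dots,\mathbf\Pi^{T-1})\le \mathbf 0_\nu,\\ & \boldsymbol\rho^0=\bar{\boldsymbol\rho}, \end{aligned} $$ with variables $\mathbf\Pi^0,\dots,\mathbf\Pi^{T-1}$ and $\boldsymbol\rho^0,\dots,\boldsymbol\rho^T$, and the problem $$ (\mathrm{P2})\quad \begin{aligned} \min_{(\boldsymbol\rho^t,\mathbf M^t)\in\mathcal M^N}\ & f(\boldsymbol\rho^1,\dots,\boldsymbol\rho^T)\\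 \text{subject to: }\ & \boldsymbol\rho^{t+1}=\mathbf M^t\mathbf 1_N,\quad t=0,\dots,T-1,\\ & \tilde{\mathbf c}(\boldsymbol\rho^0,\dots,\boldsymbol\rho^T,\mathbf M^0,\dots,\mathbf M^{T-1})\le \mathbf 0_\nu,\\ & \boldsymbol\rho^0=\bar{\boldsymbol\rho}, \end{aligned} $$ with variables $\mathbf M^0,\dots,\mathbf M^{T-1}$ and $\boldsymbol\rho^0,\dots,\boldsymbol\rho^T\in\mathbb{R}^N_{\ge0}$ (where $(\boldsymbol\rho^t,\mathbf M^t)\in\mathcal M^N$ is required for $t=0,\dots,T-1$), and where $\tilde{\mathbf c}=(\tilde c_1,\dots,\tilde c_\nu)$ is defined in the context. Then: 1. (P2) is a convex optimization problem; in particular every component $\tilde c_l$ is a convex function of $(\boldsymbol\rho^0,\dots,\boldsymbol\rho^T,\mathbf M^0,\dots,\mathbf M^{T-1})$. 2. (P1) and (P2) are equivalent under the nonlinear change of variables $\mathbf M^t:=\mathbf\Pi^t\operatorname{diag}(\boldsymbol\rho^t)$, $t=0,\dots,T-1$: they have the same optimal value, and if $(\boldsymbol\rho^t_\star)_{t=0}^{T},(\mathbf\Pi^t_\star)_{t=0}^{T-1}$ is an optimal solution of (P1), then $(\boldsymbol\rho^t_\star)_{t=0}^{T},(\mathbf\Pi^t_\star\operatorname{diag}(\boldsymbol\rho^t_\star))_{t=0}^{T-1}$ is an optimal solution of (P2). 3. Conversely, given an optimal solution $(\boldsymbol\rho^t_\star)_{t=0}^{T},(\mathbf M^t_\star)_{t=0}^{T-1}$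 of (P2), optimal matrices for (P1) are obtained as $$ \Pi^t_{\star(i,j)}=\begin{cases}\dfrac{M^t_{\star(i,j)}}{\rho^t_{\star j}} & \text{if }\rho^t_{\star j}>0,\\[2mm] \text{anything feasible} & \text{if }\rho^t_{\star j}=0,\end{cases} $$ that is, $(\boldsymbol\rho^t_\star)_{t=0}^{T}$ together with $(\mathbf\Pi^t_\star)_{t=0}^{T-1}$ is an optimal solution of (P1). Here ''anything feasible'' means that, for each $t$ and $j$ with $\rho^t_{\star j}=0$, the $j$-th column of $\mathbf\Pi^t_\star$ is any nonnegative vector whose entries sum to $1$ and which satisfies all the constraints $c_l\le 0$ of form (C) that involve column $j$ at time $t$ (such a choice exists).
   Context: Notation: $\mathbf 1_N$ is the all-ones vector in $\mathbb{R}^N$, $\mathbf 0_\nu$ the zero vector in $\mathbb{R}^\nu$, and vector inequalities are entrywise. For $\boldsymbol\rho\in\mathbb{R}^N$, $\operatorname{diag}(\boldsymbol\rho)$ is the diagonal matrix with the entries of $\boldsymbol\rho$ on its diagonal. $X_{(i,j)}$ denotes the $(i,j)$ entry of a matrix $\mathbf X$. Superscripts $t$ are time indices, not powers. Sets: - $\mathcal S^N=\{\boldsymbol\rho\in\mathbb{R}^N_{\ge0} : \mathbf 1_N^\top\boldsymbol\rho=1\}$ (probability simplex). - $\mathcal P^N=\{\mathbf\Pi\in\mathbb{R}^{N\times N}_{\ge0} : \mathbf 1_N^\top\mathbf\Pi=\mathbf 1_N^\top\}$ (column-stochastic matrices). - $\mathcal M^N=\{(\boldsymbol\rho,\mathbf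 M)\in\mathbb{R}^N_{\ge0}\times\mathbb{R}^{N\times N}_{\ge0} : \mathbf 1_N^\top\mathbf M=\boldsymbol\rho^\top\}$. Tractable constraint function: an $\mathbb{R}^\nu$-valued function $\mathbf c$ of $(\boldsymbol\rho^0,\dots,\boldsymbol\rho^T,\mathbf\Pi^0,\dots,\mathbf\Pi^{T-1})$, with $\boldsymbol\rho^t\in\mathbb{R}^N$ and $\mathbf\Pi^t\in\mathbb{R}^{N\times N}$, is called tractable if each component $c_l$, $l=1,\dots,\nu$, is of one of the following forms: - (A) $h_l(\boldsymbol\rho^0,\dots,\boldsymbol\rho^T)$ with $h_l$ a convex real-valued function; - (B) $h_l\big(\mathbf\Pi^0\operatorname{diag}(\boldsymbol\rho^0),\dots,\mathbf\Pi^{T-1}\operatorname{diag}(\boldsymbol\rho^{T-1}),\boldsymbol\rho^0,\dots,\boldsymbol\rho^T\big)$ with $h_l$ a convex real-valued function (jointly in all its arguments); - (C) $\sum_{i=1}^N\alpha_i\Pi^t_{(i,j)}-\beta$ for some $t\in\{0,\dots,T-1\}$, some column index $j\in\{1,\dots,N\}$ and some real constants $\alpha_1,\dots,\alpha_N,\beta$ (all of which may depend on $l$). Transformed constraint function $\tilde{\mathbf c}$: for each $l$, - if $c_l$ is of form (A), $\tilde c_l:=h_l(\boldsymbol\rho^0,\dots,\boldsymbol\rho^T)$; - if $c_l$ is of form (B), $\tilde c_l:=h_l(\mathbf M^0,\dots,\mathbf M^{T-1},\boldsymbol\rho^0,\dots,\boldsymbol\rho^T)$; - if $c_l$ is of form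 (C), $\tilde c_l:=\sum_{i=1}^N\alpha_iM^t_{(i,j)}-\beta\rho^t_j$ (same $t,j,\alpha_i,\beta$). The optimal value of a minimization problem is the infimum of its objective over its feasible set ($+\infty$ if infeasible). *)

(* Defs.v *)
From mathcomp Require Import all_boot all_order all_algebra.
From mathcomp Require Import all_classical all_reals all_analysis.

Set Implicit Arguments.
Unset Strict Implicit.
Unset Printing Implicit Defensive.

Import Order.TTheory GRing.Theory Num.Theory.

Local Open Scope classical_set_scope.
Local Open Scope ring_scope.

(** Minimize [objective x] over [x] in [domain] subject to [ineq l x <= 0] for
    all [l] and [eqres x = 0]. *)
Record problem (R : realType) (E : lmodType R) (nu : nat) (W : lmodType R) :=
  Problem {
    objective : E -> R;
    domain : set E;
    ineq : 'I_nu -> E -> R;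
    eqres : E -> W
  }.

Section Optimization.
Context {R : realType} {E : lmodType R} {nu : nat} {W : lmodType R}.
Implicit Type P : problem E nu W.

Definition feasible P : set E :=
  [set x | [/\ domain P x, forall l, ineq P l x <= 0 & eqres P x = 0]].

Definition optimal_value P : \bar R :=
  ereal_inf [set (objective P x)%:E | x in feasible P].

Definition optimal_solution P (x : E) : Prop :=
  feasible P x /\ forall y, feasible P y -> objective P x <= objective P y.

Definition affine_map (e : E -> W) : Prop :=
  exists (L : E -> W) (b : W), linear L /\ forall x, e x = L x + b.

Definition convex_problem P : Prop :=
  [/\ convex_function setT (objective P),
      @convex_set R E (domain P),
      forall l, convex_function setT (ineq P l)
    & affine_map (eqres P)].

End Optimization.

Definition all_ones (R : realType) (N : nat) : 'cV[R]_N := const_mx 1.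

Definition simplex (R : realType) (N : nat) : set 'cV[R]_N :=
  [set rho | rho \is a mxOver Num.nneg /\ (all_ones R N)^T *m rho = 1%:M].

Definition col_stochastic (R : realType) (N : nat) : set 'M[R]_N :=
  [set Pi | Pi \is a mxOver Num.nneg /\
            (all_ones R N)^T *m Pi = (all_ones R N)^T].

Definition mass_pairs (R : realType) (N : nat) : set ('cV[R]_N * 'M[R]_N) :=
  [set p | [/\ p.1 \is a mxOver Num.nneg, p.2 \is a mxOver Num.nneg
             & (all_ones R N)^T *m p.2 = p.1^T]].

(** Densities at the times [0, ..., T], and matrices at [0, ..., T-1]. *)
Notation densities R N T := {ffun 'I_T.+1 -> 'cV[R]_N}.
Notation matrices R N T := {ffun 'I_T -> 'M[R]_N}.

(** [t] and [t + 1] as indices of densities, for [t] an index of matrices. *)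
Definition at_time (T : nat) (t : 'I_T) : 'I_T.+1 := widen_ord (leqnSn T) t.
Definition succ_time (T : nat) (t : 'I_T) : 'I_T.+1 := lift ord0 t.

Definition flux (R : realType) (N T : nat)
    (Pi : matrices R N T) (rho : densities R N T) : matrices R N T :=
  [ffun t => Pi t *m diag_mx (rho (at_time t))^T].

(** A presentation of one scalar constraint. It is part of the data, because the
    transformed constraint depends on the form chosen, not only on the function
    that it represents. *)
Inductive constraint_form (R : realType) (N T : nat) : Type :=
  | FormA of densities R N T -> R
  | FormB of matrices R N T * densities R N T -> R
  | FormC (t : 'I_T) (j : 'I_N) (alpha : 'cV[R]_N) (beta : R).

Arguments FormA {R N T}.
Arguments FormB {R N T}.
Arguments FormC {R N T}.

Section Forms.
Context {R : realType} {N T : nat}.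
Implicit Types (a : constraint_form R N T) (rho : densities R N T)
  (Pi M : matrices R N T).

Definition convex_form a : Prop :=
  match a with
  | FormA h => convex_function setT h
  | FormB h => convex_function setT h
  | FormC _ _ _ _ => True
  end.

Definition is_formC a : bool := if a is FormC _ _ _ _ then true else false.

Definition form_eval a rho Pi : R :=
  match a with
  | FormA h => h rho
  | FormB h => h (flux Pi rho, rho)
  | FormC t j alpha beta => \sum_(i < N) alpha i 0 * Pi t i j - beta
  end.

Definition form_transform a rho M : R :=
  match a with
  | FormA h => h rho
  | FormB h => h (M, rho)
  | FormC t j alpha beta =>
      \sum_(i < N) alpha i 0 * M t i j - beta * rho (at_time t) j 0
  end.

End Forms.

Section Problems.
Context {R : realType} {N T nu : nat}.
Implicit Types (rho : densities R N T) (Pi M : matrices R N T)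
  (F : 'I_nu -> constraint_form R N T)
  (c : densities R N T -> matrices R N T -> 'cV[R]_nu).

Definition tractable_via c F : Prop :=
  (forall l, convex_form (F l)) /\
  (forall rho Pi l, c rho Pi l 0 = form_eval (F l) rho Pi).

Definition transformed F rho M : 'cV[R]_nu :=
  \col_l form_transform (F l) rho M.

Definition cost_of (f : {ffun 'I_T -> 'cV[R]_N} -> R) rho : R :=
  f [ffun t => rho (succ_time t)].

Definition problem1 (rhobar : 'cV[R]_N) (f : {ffun 'I_T -> 'cV[R]_N} -> R) c :
    problem (densities R N T * matrices R N T : lmodType R)%type nu
            ({ffun 'I_T -> 'cV[R]_N} * 'cV[R]_N : lmodType R)%type :=
  {| objective := fun x => cost_of f x.1;
     domain := [set x : densities R N T * matrices R N T |
       (forall t, x.1 t \is a mxOver Num.nneg) /\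
       (forall t, col_stochastic (x.2 t))];
     ineq := fun l x => c x.1 x.2 l 0;
     eqres := fun x =>
       ([ffun t => x.1 (succ_time t) - x.2 t *m x.1 (at_time t)],
        x.1 ord0 - rhobar) |}.

Definition problem2 (rhobar : 'cV[R]_N) (f : {ffun 'I_T -> 'cV[R]_N} -> R) F :
    problem (densities R N T * matrices R N T : lmodType R)%type nu
            ({ffun 'I_T -> 'cV[R]_N} * 'cV[R]_N : lmodType R)%type :=
  {| objective := fun x => cost_of f x.1;
     domain := [set x : densities R N T * matrices R N T |
       (forall t, x.1 t \is a mxOver Num.nneg) /\
       (forall t, mass_pairs (x.1 (at_time t), x.2 t))];
     ineq := fun l x => transformed F x.1 x.2 l 0;
     eqres := fun x =>
       ([ffun t => x.1 (succ_time t) - x.2 t *m all_ones R N],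
        x.1 ord0 - rhobar) |}.

Definition admissible_column F (t : 'I_T) (j : 'I_N) (v : 'cV[R]_N) : Prop :=
  simplex v /\
  forall l alpha beta, F l = FormC t j alpha beta ->
    \sum_(i < N) alpha i 0 * v i 0 - beta <= 0.

Definition recovered F rho M Pi : Prop :=
  forall t j,
    (0 < rho (at_time t) j 0 ->
       forall i, Pi t i j = M t i j / rho (at_time t) j 0) /\
    (rho (at_time t) j 0 = 0 -> admissible_column F t j (col j (Pi t))).

End Problems.

(* Main.v *)
(** Along [M = Pi diag rho] every quadratic expression [Pi i j * rho j] of (P1)
    becomes linear, and a constraint of form (C) becomes homogeneous of degree 1
    in column [j], i.e. it is multiplied by [rho j >= 0]; so feasible points of
    (P1) are sent to feasible points of (P2) with the same densities. The map is
    onto: where [rho j = 0] the column of [M] vanishes, and any column satisfying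
    the constraints (C) can be used for [Pi]. As the cost
    depends on the densities only, infima and minimizers correspond. *)
Require Import Defs.
From mathcomp Require Import all_boot all_order all_algebra.
From mathcomp Require Import all_classical all_reals all_analysis.

Set Implicit Arguments.
Unset Strict Implicit.
Unset Printing Implicit Defensive.

Import Order.TTheory GRing.Theory Num.Theory.
Local Open Scope classical_set_scope.
Local Open Scope ring_scope.

(** * Convexity under linear maps *)

Lemma conv_lmodE (R : realType) (E : lmodType R) (t : {i01 R})
    (x y : convex_lmodType E) :
  conv t x y = t%:num *: (x : E) + (1 - t%:num) *: (y : E).
Proof. by []. Qed.

Lemma ffun_scale_addE (R : realType) (I : finType) (E : lmodType R) (k : R)
    (x y : {ffun I -> E}) i :
  (k *: x + y) i = k *: x i + y i.
Proof. by rewrite !ffunE. Qed.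

Lemma onem_i01_ge0 (R : realType) (t : {i01 R}) : 0 <= 1 - t%:num.
Proof. by rewrite subr_ge0. Qed.

(** A linear map commutes with convex combinations, so the inequality for [h] at [L x] and [L y] is
    the one required of [h \o L]. *)
Lemma convex_function_comp_linear (R : realType) (E E' : lmodType R)
    (L : E -> E') (h : E' -> R) :
  linear L -> convex_function setT h -> convex_function setT (h \o L).
Proof.
move=> linL hh t x y _ _ /=.
have -> : L (conv t (x : convex_lmodType E) (y : convex_lmodType E))
    = conv t (L x : convex_lmodType E') (L y : convex_lmodType E').
  rewrite !conv_lmodE linL; congr (_ + _).
  (* [linear] is a bare identity on [k *: x + y]; scalar [-1] at the origin gives
     [L 0 = - L 0 + L 0]. *)
  have L0 : L 0 = 0.
    by move: (linL (-1) 0 0); rewrite !scaleN1r oppr0 add0r addNr.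
  by have := linL (1 - t%:num) y 0; rewrite addr0 L0 addr0.
by apply: hh; rewrite inE.
Qed.

Lemma convex_function_linear (R : realType) (E : lmodType R) (L : E -> R^o) :
  linear L -> convex_function setT (L : E -> R).
Proof.
move=> linL.
have idc : convex_function setT (idfun : R^o -> R) by move=> t x y _ _.
exact: convex_function_comp_linear linL idc.
Qed.

(** * Entrywise forms of the stochasticity and mass conditions *)

Section MassForms.
Context {R : realType} {N : nat}.
Implicit Types (A Pi M : 'M[R]_N) (rho : 'cV[R]_N).

Lemma all_ones_mulmxE m (A : 'M[R]_(N, m)) j :
  ((all_ones R N)^T *m A) 0 j = \sum_i A i j.
Proof. by rewrite mxE; apply: eq_bigr => i _; rewrite !mxE mul1r. Qed.

Lemma col_stochasticP Pi :
  col_stochastic Pi <->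
  (forall i j, 0 <= Pi i j) /\ (forall j, \sum_i Pi i j = 1).
Proof.
split=> [[/mxOverP Pi0 Pi1]|[Pi0 Pi1]]; split=> //.
- by move=> j; rewrite -all_ones_mulmxE Pi1 !mxE.
- exact/mxOverP.
- by apply/matrixP=> i j; rewrite ord1 all_ones_mulmxE Pi1 !mxE.
Qed.

Lemma simplexP rho :
  simplex rho <-> (forall i, 0 <= rho i 0) /\ \sum_i rho i 0 = 1.
Proof.
split=> [[/mxOverP rho0 rho1]|[rho0 rho1]]; split.
- by move=> i; exact: rho0.
- by rewrite -all_ones_mulmxE rho1 mxE.
- by apply/mxOverP=> i j; rewrite ord1; exact: rho0.
- by apply/matrixP=> i j; rewrite !ord1 all_ones_mulmxE rho1 mxE.
Qed.

Lemma mass_pairsP rho M :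
  mass_pairs (rho, M) <->
  [/\ forall j, 0 <= rho j 0, forall i j, 0 <= M i j
    & forall j, \sum_i M i j = rho j 0].
Proof.
split=> [[/mxOverP /= rho0 /mxOverP /= M0 M1]|[rho0 M0 M1]]; split=> //=.
- by move=> i; exact: rho0.
- by move=> j; rewrite -all_ones_mulmxE M1 mxE.
- by apply/mxOverP=> i j; rewrite ord1; exact: rho0.
- exact/mxOverP.
- by apply/matrixP=> i j; rewrite ord1 all_ones_mulmxE M1 mxE.
Qed.

Lemma convex_mass_pairs : convex_set (mass_pairs (R := R) (N := N)).
Proof.
move=> [r1 M1] [r2 M2] t; rewrite conv_lmodE !inE.
move=> /mass_pairsP[r10 M10 s1] /mass_pairsP[r20 M20 s2].
apply/mass_pairsP; split=> [j|i j|j].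
- by rewrite !mxE addr_ge0 // mulr_ge0 // onem_i01_ge0.
- by rewrite !mxE addr_ge0 // mulr_ge0 // onem_i01_ge0.
- rewrite !mxE -s1 -s2 !mulr_sumr -big_split /=.
  by apply: eq_bigr => i _; rewrite !mxE.
Qed.

End MassForms.

(** * The change of variables and its inverse *)

Section ChangeOfVariables.
Context {R : realType} {N T nu : nat}.
Implicit Types (rho : densities R N T) (Pi M : matrices R N T)
  (F : 'I_nu -> constraint_form R N T) (rhobar : 'cV[R]_N)
  (f : {ffun 'I_T -> 'cV[R]_N} -> R).

Lemma fluxE Pi rho t i j :
  flux Pi rho t i j = Pi t i j * rho (at_time t) j 0.
Proof. by rewrite ffunE mul_mx_diag !mxE. Qed.

(** Since [diag rho] sends the all-ones vector to [rho], the bilinear dynamics of (P1) become linear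
    in the flux. *)
Lemma flux_all_ones Pi rho t :
  flux Pi rho t *m all_ones R N = Pi t *m rho (at_time t).
Proof.
apply/matrixP=> i j; rewrite !mxE; apply: eq_bigr => k _.
by rewrite fluxE !mxE mulr1 ord1.
Qed.

(** Forms A and B keep their value by definition. Form C is multiplied by a density that may vanish,
    so only this implication holds in general. *)
Lemma form_transform_flux (a : constraint_form R N T) rho Pi :
  (forall t j, 0 <= rho t j 0) -> form_eval a rho Pi <= 0 ->
  form_transform a rho (flux Pi rho) <= 0.
Proof.
case: a => //= t j alpha beta rho0 le0.
under eq_bigr do rewrite fluxE mulrA.
by rewrite -mulr_suml -mulrBl mulr_le0_ge0.
Qed.

(** Both problems encode their equality constraints as one residual of this shape: dynamics and
    initial condition. *)
Lemma pair_ffun_subr_eq0 (u v : 'I_T -> 'cV[R]_N) (a b : 'cV[R]_N) :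
  ([ffun t => u t - v t], a - b) = 0 :> {ffun 'I_T -> 'cV[R]_N} * 'cV[R]_N <->
  (forall t, u t = v t) /\ a = b.
Proof.
split=> [e|[uv ->]].
  split=> [t|]; last exact: subr0_eq (congr1 snd e).
  have /ffunP/(_ t) := congr1 fst e.
  by rewrite !ffunE; exact: subr0_eq.
by congr pair; [apply/ffunP=> t; rewrite !ffunE uv subrr|rewrite subrr].
Qed.

Lemma problem1_eqresP rhobar f c rho Pi :
  eqres (problem1 (nu := nu) rhobar f c) (rho, Pi) = 0 <->
  (forall t, rho (succ_time t) = Pi t *m rho (at_time t)) /\
  rho ord0 = rhobar.
Proof. exact: pair_ffun_subr_eq0. Qed.

Lemma problem2_eqresP rhobar f F rho M :
  eqres (problem2 rhobar f F) (rho, M) = 0 <->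
  (forall t, rho (succ_time t) = M t *m all_ones R N) /\
  rho ord0 = rhobar.
Proof. exact: pair_ffun_subr_eq0. Qed.

Lemma mxOver_nneg_colP rho :
  (forall t, rho t \is a mxOver Num.nneg) <-> forall t j, 0 <= rho t j 0.
Proof.
split=> h t; first by move=> j; have /mxOverP := h t; exact.
by apply/mxOverP=> i j; rewrite ord1; exact: h.
Qed.

Lemma feasible_flux rhobar f c F rho Pi : tractable_via c F ->
  feasible (problem1 rhobar f c) (rho, Pi) ->
  feasible (problem2 rhobar f F) (rho, flux Pi rho).
Proof.
move=> [_ cE] [[rhoO PiS] cle /problem1_eqresP[dyn init]].
have /mxOver_nneg_colP /= rho0 := rhoO.
split.
- split=> // t /=; apply/mass_pairsP; have /col_stochasticP[Pi0 Pi1] := PiS t.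
  split=> [j|i j|j]; first exact: rho0.
    by rewrite fluxE mulr_ge0.
  by under eq_bigr do rewrite fluxE; rewrite -mulr_suml Pi1 mul1r.
- by move=> l; rewrite /= mxE form_transform_flux // -cE; exact: cle.
- by apply/problem2_eqresP; split=> // t; rewrite flux_all_ones.
Qed.

(* Where the density vanishes, so does the column of [M], since its entries are
   nonnegative and sum to the density. *)
Lemma flux_recovered F rho M Pi :
  (forall t, mass_pairs (rho (at_time t), M t)) ->
  recovered F rho M Pi -> flux Pi rho = M.
Proof.
move=> mp rec; apply/ffunP=> t; apply/matrixP=> i j; rewrite fluxE.
have /mass_pairsP[rho0 M0 Ms] := mp t.
have [PiE _] := rec t j.
have := rho0 j; rewrite le_eqVlt => /predU1P[r0|r_gt0]; last first.
  by rewrite PiE // divfK // gt_eqF.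
have Ms0 : \sum_(k < N) M t k j = 0 by rewrite Ms -r0.
by rewrite -r0 mulr0 (psumr_eq0P _ Ms0).
Qed.

(** A column with positive density is divided by its own sum; the others lie in the simplex by
    admissibility. *)
Lemma recovered_col_stochastic F rho M Pi t :
  mass_pairs (rho (at_time t), M t) -> recovered F rho M Pi ->
  col_stochastic (Pi t).
Proof.
move=> /mass_pairsP[rho0 M0 Ms] rec.
suff col j : (forall i, 0 <= Pi t i j) /\ \sum_i Pi t i j = 1.
  by apply/col_stochasticP; split=> [i j|j]; have [] := col j.
have [PiE adm] := rec t j.
have := rho0 j; rewrite le_eqVlt => /predU1P[r0|r_gt0].
  have [/simplexP[v0 v1] _] := adm (esym r0).
  split=> [i|]; first by have := v0 i; rewrite mxE.
  by rewrite -v1; apply: eq_bigr => i _; rewrite mxE.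
split=> [i|]; first by rewrite PiE // divr_ge0 // ltW.
under eq_bigr do rewrite PiE //.
by rewrite -mulr_suml Ms divff // gt_eqF.
Qed.

Lemma feasible_recovered rhobar f c F rho M Pi : tractable_via c F ->
  feasible (problem2 rhobar f F) (rho, M) -> recovered F rho M Pi ->
  feasible (problem1 rhobar f c) (rho, Pi).
Proof.
move=> [_ cE] [[rhoO mp] cle /problem2_eqresP[dyn init]] rec.
have /mxOver_nneg_colP /= rho0 := rhoO.
have fluxM : flux Pi rho = M := flux_recovered mp rec.
split.
- by split=> // t; exact: recovered_col_stochastic (mp t) rec.
- move=> l /=; have := cle l; rewrite /= mxE cE.
  case El : (F l) => [h|h|t j alpha beta] //=; first by rewrite fluxM.
  have [PiE adm] := rec t j.
  (* At zero density the transformed constraint is void and is discarded: only admissibility of the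
     column bounds the original one. *)
  have := rho0 (at_time t) j; rewrite le_eqVlt => /predU1P[r0 _|r_gt0].
    have [_ /(_ l _ _ El) le0] := adm (esym r0).
    rewrite (eq_bigr (fun i => alpha i 0 * col j (Pi t) i 0)) // => i _.
    by rewrite [col _ _ _ _]mxE.
  (* With [M] written as a flux, the transformed constraint is the original times a positive
     density, which cancels. *)
  rewrite -fluxM; under eq_bigr do rewrite fluxE mulrA.
  by rewrite -mulr_suml -mulrBl pmulr_lle0.
- by apply/problem1_eqresP; split=> // t; rewrite -flux_all_ones fluxM.
Qed.

Lemma exists_recovered c F rho M : tractable_via c F ->
  (exists Pi : matrices R N T,
     (forall t, col_stochastic (Pi t)) /\
     (forall l, is_formC (F l) ->
        forall rho : densities R N T, c rho Pi l 0 <= 0)) ->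
  exists Pi, recovered F rho M Pi.
Proof.
move=> [_ cE] [Pi0 [st le0]].
(* Columns without mass are borrowed from the tuple satisfying all the constraints of form C. *)
exists [ffun t => \matrix_(i, j) if rho (at_time t) j 0 == 0 then Pi0 t i j
                                 else M t i j / rho (at_time t) j 0].
move=> t j; split=> [r_gt0 i|r0]; first by rewrite ffunE mxE gt_eqF.
rewrite ffunE.
have colE i : col j (\matrix_(i, j) if rho (at_time t) j 0 == 0 then Pi0 t i j
    else M t i j / rho (at_time t) j 0) i 0 = Pi0 t i j.
  by rewrite !mxE r0 eqxx.
have /col_stochasticP[p0 p1] := st t.
split.
  by apply/simplexP; split=> [i|]; [rewrite colE|under eq_bigr do rewrite colE].
move=> l alpha beta El; under eq_bigr do rewrite colE.
(* Form C ignores the densities, so the hypothesis may be taken at density 0. *)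
by have := le0 l; rewrite El => /(_ isT 0); rewrite cE El.
Qed.

(** * Convexity of (P2) *)

Lemma convex_form_transform (a : constraint_form R N T) : convex_form a ->
  convex_function setT
    (fun x : densities R N T * matrices R N T => form_transform a x.1 x.2).
Proof.
case: a => [h|h|t j alpha beta] /= ch.
- by apply: (convex_function_comp_linear (L := fst) (h := h)) ch.
(* The linear map swaps the components, as [h] takes the matrices first. *)
- apply: (convex_function_comp_linear
    (L := fun x : densities R N T * matrices R N T => (x.2, x.1)) (h := h)) ch.
  by move=> k x y.
(* The factor [rho j] on [beta] removes the constant term: form C becomes linear, not merely
   affine. *)
- apply: convex_function_linear => k x y.
  rewrite /= !ffun_scale_addE !mxE scalerBr addrACA -opprD; congr (_ - _).
    rewrite scaler_sumr -big_split; apply: eq_bigr => i _ /=.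
    by rewrite !mxE mulrDr mulrCA.
  by rewrite mulrDr mulrCA.
Qed.

Lemma convex_transformed c F l : tractable_via c F ->
  convex_function setT (fun x : densities R N T * matrices R N T =>
    transformed F x.1 x.2 l 0).
Proof.
move=> [cF _].
have -> : (fun x : densities R N T * matrices R N T =>
    transformed F x.1 x.2 l 0) =
  fun x => form_transform (F l) x.1 x.2 by apply/funext=> x; rewrite mxE.
exact: convex_form_transform.
Qed.

Lemma convex_problem2 rhobar f c F :
  convex_function setT f -> tractable_via c F ->
  convex_problem (problem2 rhobar f F).
Proof.
move=> cf tr; split.
- apply: (convex_function_comp_linear (h := f)
    (L := fun x : densities R N T * matrices R N T =>
            [ffun t => x.1 (succ_time t)])) cf.
  by move=> k x y; apply/ffunP=> t; rewrite !ffunE.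
- move=> x y t; rewrite conv_lmodE !inE => -[x0 xm] [y0 ym]; split=> s /=.
    apply/mxOverP=> i j; rewrite !ffunE !mxE.
    by apply: addr_ge0; apply: mulr_ge0 => //; rewrite ?onem_i01_ge0 //;
       [have /mxOverP := x0 s|have /mxOverP := y0 s]; exact.
  have := convex_mass_pairs t (mem_set (xm s)) (mem_set (ym s)).
  by rewrite conv_lmodE inE /= !ffunE.
- by move=> l; exact: convex_transformed tr.
- exists (fun x : densities R N T * matrices R N T =>
    ([ffun t => x.1 (succ_time t) - x.2 t *m all_ones R N], x.1 ord0)).
  (* The only constant in the residual comes from the initial condition. *)
  exists (0, - rhobar); split=> [k x y|x] /=.
    congr pair; last by rewrite /= !ffunE.
    apply/ffunP=> t; rewrite !ffunE /= mulmxDl -scalemxAl scalerBr.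
    by rewrite opprD addrACA.
  by congr pair; rewrite /= ?addr0.
Qed.

End ChangeOfVariables.

Theorem mainTheorem1 (R : realType) (N T nu : nat)
    (hN : (1 <= N)%N) (hT : (1 <= T)%N) (hnu : (1 <= nu)%N)
    (rhobar : 'cV[R]_N) (hrhobar : simplex rhobar)
    (f : {ffun 'I_T -> 'cV[R]_N} -> R) (hf : convex_function setT f)
    (c : densities R N T -> matrices R N T -> 'cV[R]_nu)
    (F : 'I_nu -> constraint_form R N T) (hc : tractable_via c F)
    (hI : exists Pi : matrices R N T,
        (forall t, col_stochastic (Pi t)) /\
        (forall l, is_formC (F l) ->
           forall rho : densities R N T, c rho Pi l 0 <= 0)) :
  [/\ convex_problem (problem2 rhobar f F) /\
      (forall l, convex_function setT
         (fun x : densities R N T * matrices R N T =>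
            transformed F x.1 x.2 l 0)),
      optimal_value (problem1 rhobar f c) = optimal_value (problem2 rhobar f F) /\
      (forall (rho : densities R N T) (Pi : matrices R N T),
         optimal_solution (problem1 rhobar f c) (rho, Pi) ->
         optimal_solution (problem2 rhobar f F) (rho, flux Pi rho))
    & forall (rho : densities R N T) (M : matrices R N T),
        optimal_solution (problem2 rhobar f F) (rho, M) ->
        (exists Pi : matrices R N T, recovered F rho M Pi) /\
        (forall Pi : matrices R N T, recovered F rho M Pi ->
           optimal_solution (problem1 rhobar f c) (rho, Pi))].
Proof.
have ex2 rho M : exists Pi, recovered F rho M Pi := exists_recovered rho M hc hI.
split.
- by split; [exact: convex_problem2 hf hc|move=> l; exact: convex_transformed hc].
- split.
    (* Both maps keep the densities, hence the cost, so the two sets of attained costs coincide. *)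
    congr ereal_inf; apply/seteqP; split=> r [[rho X] feas <-].
      by exists (rho, flux X rho) => //; exact: feasible_flux feas.
    have [Pi rec] := ex2 rho X.
    by exists (rho, Pi) => //; exact: feasible_recovered feas rec.
  move=> rho Pi [feas opt]; split; first exact: feasible_flux feas.
  (* Any competitor in (P2) is pulled back to one in (P1) of equal cost. *)
  move=> [rho' M'] feas'; have [Pi' rec] := ex2 rho' M'.
  exact: (opt _ (feasible_recovered hc feas' rec)).
- move=> rho M [feas opt]; split=> // Pi rec.
  split; first exact: feasible_recovered feas rec.
  by move=> [rho' Pi'] /(feasible_flux hc)/opt.
Qed.
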